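(* Let $p$ be an odd prime, $m,s$ positive integers, and $\mathcal{R}=\mathbb{F}_{p^m}[u,v]/\langle u^2,v^2,uv-vu\rangle$. Let $\alpha=\alpha_1+\alpha_3v+\alpha_4uv\in\mathcal{R}$ with $\alpha_1,\alpha_3,\alpha_4\in\mathbb{F}_{p^m}^*$, and suppose $\alpha$ is not a square in $\mathcal{R}$. Let $\alpha_0\in\mathbb{F}_{p^m}$ be the element with $\alpha_0^{p^s}=\alpha_1$. Let $\mathcal{C}=\langle (x^2-\alpha_0)^\ell+u(x^2-\alpha_0)^tz(x),\ u(x^2-\alpha_0)^\mu\rangle$ be the ideal of $\mathcal{R}_\alpha=\mathcal{R}[x]/\langle x^{2p^s}-\alpha\rangle$, where $0\le\ell\le 2p^s-1$, $0\le t<\ell$, $z(x)$ is $0$ or a unit, and $0\le\mu<\Im$, where $\Im$ is the smallest non-negative integer such that $u(x^2-\alpha_0)^{\Im}\in\langle (x^2-\alpha_0)^\ell+u(x^2-\alpha_0)^tz(x)\rangle$. Then the symbol-pair distance of $\mathcal{C}$ is $$d_{sp}(\mathcal{C})=\begin{cases}2 & \text{if } 0\le\mu\le p^s;\\ 2(\Gamma+1)p^{\gamma} & \text{if } 2p^s-p^{s-\gamma}+(\Gamma-1)p^{s-\gamma-1}+1\le\mu\le 2p^s-p^{s-\gamma}+\Gamma p^{s-\gamma-1},\\ & \text{where } 1\le\Gamma\le p-1 \text{ and } 0\le\gamma\le s-1.\end{cases}$$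
   Context: Elements of $\mathcal{R}_\alpha=\mathcal{R}[x]/\langle x^{2p^s}-\alpha\rangle$ are identified with vectors in $\mathcal{R}^{2p^s}$: the class whose representative of degree less than $2p^s$ is $\zeta_0+\zeta_1x+\cdots+\zeta_{2p^s-1}x^{2p^s-1}$ corresponds to $(\zeta_0,\ldots,\zeta_{2p^s-1})$. Ideals of $\mathcal{R}_\alpha$ are thereby the $\alpha$-constacyclic codes of length $2p^s$ over $\mathcal{R}$. For vectors $x=(x_0,\ldots,x_{n-1})$, $y=(y_0,\ldots,y_{n-1})$ over an alphabet, the symbol-pair distance is $d_{sp}(x,y)=|\{i:0\le i\le n-1,\ (x_i,x_{i+1})\ne(y_i,y_{i+1})\}|$, indices taken modulo $n$; for a code $\mathcal{C}$ with at least two words, $d_{sp}(\mathcal{C})=\min\{d_{sp}(x,y):x,y\in\mathcal{C},x\ne y\}$. When $z(x)$ is a unit, it is represented as a finite sum $z(x)=\sum_{\kappa}(z_{0\kappa}x+z_{1\kappa})(x^2-\alpha_0)^\kappa$ with $z_{0\kappa},z_{1\kappa}\in\mathbb{F}_{p^m}$ and $z_{00}x+z_{10}\ne0$. *)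

(* Defs.v *)
From HB Require Import structures.
From mathcomp Require Import all_boot all_algebra.

Set Implicit Arguments.
Unset Strict Implicit.
Unset Printing Implicit Defensive.

Import GRing.Theory.
Local Open Scope ring_scope.

HB.instance Definition _ (A : finComNzRingType) (h : {poly A}) :=
  Finite.on {poly %/ h}.

(* F[u,v]/<u^2, v^2, uv - vu>, built as (F[u]/<u^2>)[v]/<v^2>. *)
Definition Ruv (F : finFieldType) : finComNzRingType :=
  {poly %/ ('X^2 : {poly {poly %/ ('X^2 : {poly F})}})}.

Definition constF (F : finFieldType) (a : F) : Ruv F :=
  qpolyC _ (qpolyC _ a).
Definition uR (F : finFieldType) : Ruv F := qpolyC _ 'qX.
Definition vR (F : finFieldType) : Ruv F := 'qX.
Arguments uR {F}.
Arguments vR {F}.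

Definition Rconst (R : finComNzRingType) (n : nat) (alpha : R) :
    finComNzRingType :=
  {poly %/ ('X^n - alpha%:P)}.

(* The elements of a quotient by a monic polynomial of degree n > 0 are stored
   as their representatives of degree less than n. *)
Definition word_of (R : finComNzRingType) (n : nat) (alpha : R)
    (c : Rconst n alpha) : 'rV[R]_n :=
  poly_rV (polyn c).

Definition ideal1 (A : finComNzRingType) (g : A) : {set A} :=
  [set a * g | a : A].
Definition ideal2 (A : finComNzRingType) (g h : A) : {set A} :=
  [set a * g + b * h | a : A, b : A].

(* [ordS i] is i + 1 modulo n. *)
Definition dsp (A : eqType) (n : nat) (x y : 'rV[A]_n) : nat :=
  #|[set i | (x ord0 i, x ord0 (ordS i)) != (y ord0 i, y ord0 (ordS i))]|.

(* The default value n does not affect the minimum, as dsp x y <= n; it is the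
   value given to codes with fewer than two words. *)
Definition dsp_code (A : finType) (n : nat) (C : {set 'rV[A]_n}) : nat :=
  \big[minn/n]_(x in C) \big[minn/n]_(y in C | x != y) dsp x y.

Section ConstacyclicRing.
Variables (F : finFieldType) (n : nat) (alpha : Ruv F).
Local Notation Ra := (Rconst n alpha).

Definition toRa (a : Ruv F) : Ra := qpolyC _ a.
Definition xRa : Ra := 'qX.

Definition is_unit (z : Ra) : Prop := exists w : Ra, z * w = 1.

Definition unit_form (alpha0 : F) (z : Ra) : Prop :=
  exists (N : nat) (z0 z1 : nat -> F),
    toRa (constF (z0 0%N)) * xRa + toRa (constF (z1 0%N)) != 0
    /\ z = \sum_(k < N.+1)
             (toRa (constF (z0 k)) * xRa + toRa (constF (z1 k)))
             * (xRa ^+ 2 - toRa (constF alpha0)) ^+ k.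

End ConstacyclicRing.
Arguments toRa {F n alpha}.
Arguments xRa {F n alpha}.

(* Main.v *)
Require Import Defs.
From HB Require Import structures.
From mathcomp Require Import all_boot all_algebra finfield.
From mathcomp Require Import ring zify.

(** Put N = p^s and Q = X^2 - alpha0.  In R_alpha one has
    Q(x)^N = v (alpha3 + alpha4 u), so v is a unit multiple of Q(x)^N and
    R_alpha = F[u][x] / (u^2, Q^(2N)).  Multiplying a codeword by u cannot
    enlarge its support, so the minimum distance is reached on the words killed
    by u, and the minimality of [tor] shows that these are the u Q^mu P.  If
    mu <= N they include uv, of pair weight 2.  If mu >= N they are the
    uv P with P a multiple of Q^(mu - N) of degree < 2N over F; the parts of
    even and odd degree of P are multiples of (X - alpha0)^(mu - N) in X^2, and
    each position of one parity contributes two positions to the pair weight, so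
    the pair weight is at least twice the Hamming distance of the constacyclic code
    generated by (X - alpha0)^(mu - N), of length p^s.  The latter is computed by
    writing a polynomial as (X - a)^(k q) g with q = p^(s-1), k maximal: its
    weight is at least k + 1 times that of g mod (X - a)^q = X^q - a^q. *)

Set Implicit Arguments.
Unset Strict Implicit.
Unset Printing Implicit Defensive.

Import GRing.Theory.
Local Open Scope ring_scope.

(** * Hamming weight of polynomials *)

Section HammingWeight.
Variable R : comNzRingType.
Implicit Types (c d : {poly R}).

Definition hwt c := (\sum_(i < size c) (c`_i != 0)%R)%N.

(** Padding with zero coefficients allows polynomials of different sizes to be compared over one
    range of indices. *)
Lemma hwtE n c : (size c <= n)%N -> hwt c = (\sum_(i < n) (c`_i != 0)%R)%N.
Proof.
move=> le_cn; rewrite /hwt -(big_mkord xpredT (fun i =>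
  nat_of_bool (c`_i != 0)%R)).
rewrite -[RHS](big_mkord xpredT (fun i => nat_of_bool (c`_i != 0)%R)).
rewrite [RHS](big_cat_nat _ (n := size c)) //= [X in (_ + X)%N]big_nat_cond [X
  in (_ + X)%N]big1 ?addn0 //.
by move=> i /andP[/andP[le_ci _] _]; rewrite nth_default ?eqxx.
Qed.

Lemma hwt_le_size c : (hwt c <= size c)%N.
Proof.
rewrite -[leqRHS]card_ord -sum1_card leq_sum // => i _; exact: leq_b1.
Qed.

Lemma hwt_gt0 c : c != 0 -> (0 < hwt c)%N.
Proof.
move=> nz_c; have sc : ((size c).-1 < size c)%N
  by rewrite prednK ?size_poly_gt0.
by rewrite /hwt (bigD1 (Ordinal sc)) //= -lead_coefE lead_coef_eq0 nz_c.
Qed.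

Lemma hwt0 : hwt 0 = 0%N.
Proof. by rewrite /hwt size_poly0 big_ord0. Qed.

Lemma hwtD c d : (hwt (c + d) <= hwt c + hwt d)%N.
Proof.
set n := maxn (size c) (size d).
rewrite (@hwtE n c) ?leq_maxl // (@hwtE n d) ?leq_maxr //.
rewrite (@hwtE n) ?size_polyD // -big_split leq_sum //= => i _.
rewrite coefD; case: eqVneq => // nz.
by case: eqVneq => // c0; case: eqVneq => // d0; rewrite c0 d0 addr0 eqxx in nz.
Qed.

Lemma hwtZ a c : (hwt (a *: c) <= hwt c)%N.
Proof.
rewrite (@hwtE (size c)) ?size_scale_leq // leq_sum // => i _.
by rewrite coefZ; case: (eqVneq c`_i) => [->|_]; rewrite ?mulr0 ?eqxx ?leq_b1.
Qed.

Lemma hwt_cons a c : hwt (c * 'X + a%:P) = ((a != 0)%R + hwt c)%N.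
Proof.
rewrite (@hwtE (size c).+1).
  rewrite big_ord_recl coefD coefMX coefC add0r; congr addn.
  by apply: eq_bigr => i _; rewrite coefD coefMX coefC addr0.
rewrite (leq_trans (size_polyD _ _)) // geq_max.
rewrite (leq_trans (size_polyMleq _ _)) ?size_polyX ?addn2 //.
by rewrite (leq_trans (size_polyC_leq1 _)).
Qed.

Lemma hwtMX c : hwt (c * 'X) = hwt c.
Proof. by rewrite -[c * 'X]addr0 hwt_cons eqxx. Qed.

(** Horner induction on [c]: each nonzero coefficient contributes one shifted scalar multiple of
    [d]. *)
Lemma hwtM c d : (hwt (c * d) <= hwt c * hwt d)%N.
Proof.
elim/poly_ind: c => [|c a IH]; first by rewrite mul0r hwt0.
rewrite hwt_cons mulrDl -mulrA -commr_polyX mulrA mulnDl.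
rewrite (leq_trans (hwtD _ _)) // addnC hwtMX leq_add //.
case: eqVneq => [->|_]; first by rewrite mul0r hwt0.
by rewrite mul_polyC mul1n hwtZ.
Qed.

(* [c] is the sum over j < q of X^j times [section_poly q j c] evaluated at
  X^q. *)
Definition section_poly q j c := \poly_(i < size c) c`_(i * q + j).

Lemma coef_section_poly q j c i : (0 < q)%N -> (section_poly q j c)`_i = c`_(i
  * q + j).
Proof.
move=> q0; rewrite coef_poly; case: ltnP => // le_ci; rewrite nth_default //.
by rewrite (leq_trans le_ci) // (leq_trans (leq_pmulr _ q0)) ?leq_addr.
Qed.

Lemma hwt_section q c : (0 < q)%N -> hwt c = (\sum_(j < q) hwt (section_poly q
  j c))%N.
Proof.
move=> q0; set n := size c.
rewrite (@hwtE (n * q)) ?leq_pmulr //.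
rewrite [RHS](eq_bigr (fun j : 'I_q =>
  \sum_(i < n) (c`_(i * q + j) != 0)%R)%N); last first.
  move=> j _; rewrite (@hwtE n) ?size_poly //.
  by apply: eq_bigr => i _; rewrite coef_section_poly.
rewrite exchange_big /=; elim: n => [|n IH]; first by rewrite !big_ord0.
rewrite [RHS]big_ord_recr /= -IH mulSnr big_split_ord /=; congr addn.
Qed.

(** A factor in [X^q] shifts exponents by multiples of [q], so it never mixes residue classes modulo
    [q]. *)
Lemma section_poly_comp q j c d : (j < q)%N ->
  section_poly q j ((c \Po 'X^q) * d) = c * section_poly q j d.
Proof.
move=> jq; have q0 : (0 < q)%N by lia.
elim/poly_ind: c => [|c a IH].
  apply/polyP => i; rewrite coef_section_poly // comp_polyC !mul0r !coef0 //.
rewrite comp_polyD comp_polyC comp_polyM comp_polyX !mulrDl.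
rewrite (mulrAC c) (mulrAC (c \Po _)) -IH; apply/polyP => i.
rewrite coef_section_poly // !coefD !coefCM coefMX coefMXn.
congr (_ + _); last by rewrite coef_section_poly.
case: i => [|i] /=; first by rewrite mul0n jq.
rewrite coef_section_poly // mulSn ifN; last by lia.
by congr (_`_ _); lia.
Qed.

Lemma section_poly_small q j c : (size c <= q)%N -> (j < q)%N ->
  section_poly q j c = (c`_j)%:P.
Proof.
move=> le_cq jq; have q0 : (0 < q)%N by lia.
apply/polyP => i; rewrite coef_section_poly // coefC.
by case: i => [|i] //=; rewrite nth_default // (leq_trans le_cq) //
  mulSn -addnA leq_addr.
Qed.

Lemma section_polyD q j c d : (0 < q)%N ->
  section_poly q j (c + d) = section_poly q j c + section_poly q j d.
Proof. by move=> q0; apply/polyP => i;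
  rewrite coefD !coef_section_poly // coefD. Qed.

Lemma size_section_poly q j n c : (0 < q)%N -> (size c <= n * q)%N ->
  (size (section_poly q j c) <= n)%N.
Proof.
move=> q0 le_c; apply/leq_sizeP => i le_ni; rewrite coef_section_poly //.
by rewrite nth_default // (leq_trans le_c) //
  (leq_trans (leq_mul le_ni (leqnn q))) ?leq_addr.
Qed.

Lemma hwt_comp_Xn q c : (0 < q)%N -> (hwt (c \Po 'X^q) = hwt c)%N.
Proof.
move=> q0; rewrite (hwt_section (c \Po _) q0) (bigD1 (Ordinal q0)) //= big1.
  rewrite -[c \Po _]mulr1 section_poly_comp //
    section_poly_small ?size_poly1 //.
  by rewrite coef1 mulr1 addn0.
move=> j nz_j; rewrite -[c \Po _]mulr1 section_poly_comp //
  section_poly_small ?size_poly1 //.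
by rewrite coef1 -[nat_of_ord j == _]/(j == Ordinal q0) (negPf nz_j) mulr0 hwt0.
Qed.
End HammingWeight.

(** * Repeated roots in characteristic p *)

Section RepeatedRootBound.
Variables (F : fieldType) (p : nat).
Hypothesis pcharF : p \in [pchar F].
Implicit Types (a : F) (c d : {poly F}).

Let p_prime : prime p. Proof. by case/andP: pcharF. Qed.
Let p_gt0 : (0 < p)%N := prime_gt0 p_prime.

Lemma sub_exp_pchar e (A : comNzRingType) (x y : A) : p \in [pchar A] ->
  (x - y) ^+ (p ^ e) = x ^+ (p ^ e) - y ^+ (p ^ e).
Proof.
move=> chA; elim: e => [|e IH]; first by rewrite expn0 !expr1.
rewrite expnSr !exprM IH -!(pFrobenius_autE chA) pFrobenius_autB_comm //.
exact: mulrC.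
Qed.

(** Written as a composition with a power of [X], the shape that [section_poly_comp] and
    [hwt_comp_Xn] accept. *)
Lemma XsubC_exp_pchar e a :
  ('X - a%:P) ^+ (p ^ e) = ('X - (a ^+ (p ^ e))%:P) \Po 'X^(p ^ e).
Proof.
by rewrite sub_exp_pchar ?pchar_poly //
  comp_polyB comp_polyX comp_polyC rmorphXn.
Qed.

(** A polynomial with a single term has no nonzero root. *)
Lemma hwt_mul_root_gt1 a c : a != 0 -> c != 0 -> ('X - a%:P) %| c -> (1 < hwt
  c)%N.
Proof.
move=> nz_a nz_c; rewrite dvdp_XsubCl => /rootP ca0.
have sc : ((size c).-1 < size c)%N by rewrite prednK ?size_poly_gt0.
have [|all0] := altP (@existsP _ (fun i : 'I_(size c) =>
  (i != Ordinal sc) && (c`_i != 0))).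
  case=> i /andP[neq_i nz_i].
  rewrite /hwt (bigD1 (Ordinal sc)) //= -lead_coefE lead_coef_eq0 nz_c.
  by rewrite (bigD1 i) //= nz_i.
move: ca0; rewrite horner_coef (bigD1 (Ordinal sc)) //= big1 => [|i neq_i].
  move/eqP; rewrite addr0 -lead_coefE mulf_eq0 lead_coef_eq0 (negPf nz_c) /=.
  by rewrite expf_eq0 (negPf nz_a) andbF.
move: all0; rewrite negb_exists => /forallP/(_ i).
by rewrite neq_i negbK => /eqP->; rewrite mul0r.
Qed.

(** Induction on the size. If the constant term vanishes, divide by [X], which is coprime to
    [X - a]. Otherwise differentiate: the constant term disappears from the weight and the
    multiplicity drops by at most one. Since the size is at most [p], the exponents that occur are
    nonzero in [F], so only constants have zero derivative. *)
Lemma hwt_gt_mult_small a k c : a != 0 -> c != 0 -> (size c <= p)%N ->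
  ('X - a%:P) ^+ k %| c -> (k < hwt c)%N.
Proof.
move=> nz_a; move: {2}(size c) (leqnn (size c)) => n.
elim: n c k => [|n IH] c k; first by rewrite leqn0 size_poly_eq0 => ->.
elim/poly_ind: c => [|c b _]; first by rewrite eqxx.
move=> le_sn nz_c le_sp; rewrite hwt_cons.
case: k => [|k] dvd_c.
  by rewrite -hwt_cons hwt_gt0.
have [b0|nz_b] := eqVneq b 0.
  move: nz_c le_sn le_sp dvd_c; rewrite b0 addr0 add0n mulf_eq0 negb_or
    polyX_eq0 andbT.
  move=> nz_c; rewrite size_mulX // ltnS => le_sn lt_sp.
  rewrite Gauss_dvdpl => [dvd_c|]; first by apply: IH => //; exact: ltnW.
  by rewrite coprimep_expl // coprimepX root_XsubC eq_sym.
have lt_sc : (size c < p)%N.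
  have [->|nz_c'] := eqVneq c 0; first by rewrite size_poly0.
  by move: le_sp; rewrite size_MXaddC (negPf nz_c').
have nat_neq0 i : (i < size c)%N -> (i.+1%:R : F) != 0.
  move=> lt_i; rewrite -(dvdn_pcharf pcharF); apply/negP => /dvdn_leq; lia.
have dE i : (c * 'X + b%:P)^`()`_i = c`_i *+ i.+1.
  by rewrite coef_deriv coefD coefMX coefC addr0.
have d_neq0 : (c * 'X + b%:P)^`() != 0.
  apply/eqP => d0.
  have c0 : c = 0.
    apply/polyP => i; rewrite coef0; case: (ltnP i (size c)) => [lt_i|];
      last first.
      by move=> ?; rewrite nth_default.
    move/(congr1 (fun d : {poly F} => d`_i)): d0; rewrite dE coef0 -mulr_natr.
    by move/eqP; rewrite mulf_eq0 (negPf (nat_neq0 i lt_i)) orbF => /eqP.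
  move: dvd_c; rewrite c0 mul0r add0r => /dvdp_leq.
  rewrite polyC_eq0 nz_b size_exp_XsubC size_polyC nz_b => /(_ isT).
  by rewrite ltnS.
have size_d : (size (c * 'X + b%:P)^`() <= size c)%N.
  by apply/leq_sizeP => i le_i; rewrite dE nth_default ?mul0rn.
have dvd_d : ('X - a%:P) ^+ k %| (c * 'X + b%:P)^`().
  case/dvdpP: dvd_c => h ->; rewrite derivM deriv_exp derivXsubC mul1r /=.
  by rewrite exprS mulrA dvdp_add ?dvdp_mull // -mulr_natl dvdp_mull.
have lt_dn : (size (c * 'X + b%:P)^`() <= n)%N.
  rewrite (leq_trans size_d) // -ltnS (leq_trans _ le_sn) //.
  have [c0|nz_c'] := eqVneq c 0; last by rewrite size_MXaddC (negPf nz_c').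
  by move: d_neq0; rewrite c0 mul0r add0r derivC eqxx.
rewrite add1n ltnS; apply: leq_trans (IH _ k lt_dn d_neq0 _ dvd_d) _.
  by rewrite (leq_trans size_d) // ltnW.
rewrite (hwtE size_d) /hwt leq_sum // => i _.
by rewrite dE; case: (eqVneq c`_i) => [->|_]; rewrite ?mul0rn ?eqxx ?leq_b1.
Qed.

(** With [q = p ^ e], [k] is the largest number of factors [('X - a%:P) ^+ q] in [c], and [r] is the
    remainder of the cofactor modulo one more such factor. Each nonzero coefficient of [r] makes the
    corresponding section of [c] nonzero; that section has size at most [p] and is divisible by
    [Q ^+ k], so it has more than [k] terms. The last clause hands the leftover multiplicity to [r],
    ready for induction. *)
Lemma hwt_reduction e a c : a != 0 -> c != 0 -> (size c <= p * p ^ e)%N ->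
  exists k, exists2 r : {poly F}, [&& (k < p)%N, r != 0, (size r <= p ^ e)%N
    & (k.+1 * hwt r <= hwt c)%N] &
    forall i, ('X - a%:P) ^+ i %| c -> ('X - a%:P) ^+ (i - k * p ^ e) %| r.
Proof.
move=> nz_a nz_c size_c; set q := (p ^ e)%N in size_c *.
have q_gt0 : (0 < q)%N by rewrite expn_gt0 p_gt0.
set Q := ('X - (a ^+ q)%:P : {poly F}).
have QE : ('X - a%:P) ^+ q = Q \Po 'X^q by exact: XsubC_exp_pchar.
have nz_A : a ^+ q != 0 by rewrite expf_neq0.
have ex0 : exists k, ('X - a%:P) ^+ (k * q) %| c by exists 0%N;
  rewrite mul0n dvd1p.
have bound k : ('X - a%:P) ^+ (k * q) %| c -> (k <= p)%N.
  move/dvdp_leq => /(_ nz_c); rewrite size_exp_XsubC => lt_k.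
  by rewrite -(leq_pmul2r q_gt0) ltnW // (leq_trans lt_k).
case: (ex_maxnP ex0 bound) => k dvd_k max_k.
have size_Xaq : size (('X - a%:P) ^+ q) = q.+1 by rewrite size_exp_XsubC.
have lt_kp : (k < p)%N.
  have := dvdp_leq nz_c dvd_k; rewrite size_exp_XsubC => lt_k.
  by rewrite -(ltn_pmul2r q_gt0) (leq_trans lt_k).
case/dvdpP: dvd_k => g cE; pose r : {poly F} := g %% (('X - a%:P) ^+ q).
have nz_Xaq : ('X - a%:P) ^+ q != 0 by rewrite -size_poly_gt0 size_Xaq.
have nz_r : r != 0.
  apply/negP => /eqP r0; suff /max_k : ('X - a%:P) ^+ (k.+1 * q) %| c
    by rewrite ltnn.
  by rewrite cE mulSn exprD dvdp_mul // /dvdp -/r r0.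
have size_r : (size r <= q)%N by rewrite -ltnS -size_Xaq ltn_modp.
have gE j : (j < q)%N ->
  section_poly q j g = Q * section_poly q j (g %/ (('X - a%:P) ^+ q)) +
    (r`_j)%:P.
  move=> lt_j; rewrite [in LHS](divp_eq g (('X - a%:P) ^+ q)) section_polyD //.
  rewrite [_ %/ _ * _]mulrC {1}QE section_poly_comp //; congr (_ + _).
  exact: section_poly_small.
exists k; exists r; first (apply/and4P; split=> //).
  rewrite (hwt_section c q_gt0) (hwtE size_r) big_distrr /= leq_sum // => j _.
  case: (eqVneq r`_j 0) => [_|nz_rj]; first by rewrite muln0.
  have cjE : section_poly q j c = Q ^+ k * section_poly q j g.
    rewrite cE mulrC mulnC exprM QE -rmorphXn /=.
    by rewrite section_poly_comp.
  rewrite muln1 (@hwt_gt_mult_small (a ^+ q)) //.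
  - rewrite cjE mulf_neq0 ?expf_neq0 ?polyXsubC_eq0 // gE //.
    (* At the root [a ^+ q] of [Q], the section of [g] takes the value of the coefficient of [r],
       which is nonzero. *)
    apply/negP => /eqP/(congr1 (horner^~ (a ^+ q))).
    by rewrite !hornerE subrr mul0r add0r => /eqP; apply/negP.
  - exact: size_section_poly.
  - by rewrite cjE dvdp_mulr.
move=> i dvd_i; have [le_i|/ltnW le_i] := leqP i (k * q).
  by rewrite (eqP le_i) dvd1p.
have lt_ik : (i - k * q <= q)%N.
  rewrite leqNgt; apply/negP => lt_q;
    suff /max_k : ('X - a%:P) ^+ (k.+1 * q) %| c by rewrite ltnn.
  by apply: dvdp_trans dvd_i; apply: dvdp_exp2l; lia.
have dvd_g : ('X - a%:P) ^+ (i - k * q) %| g.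
  move: dvd_i; rewrite cE -{1}(subnK le_i) exprD dvdp_mul2r //.
  by rewrite expf_neq0 // polyXsubC_eq0.
by rewrite -(@dvdp_mod _ _ (('X - a%:P) ^+ q)) // dvdp_exp2l.
Qed.

(** Induction on [gamma], with [s] lowered at the same time: each application of [hwt_reduction]
    contributes a factor [p], until [gamma = 0] leaves the factor [Gamma + 1]. *)
Lemma hwt_repeated_root s gamma Gamma i a c :
  (gamma < s)%N -> (1 <= Gamma <= p - 1)%N ->
  (p ^ s - p ^ (s - gamma) + (Gamma - 1) * p ^ (s - gamma - 1) + 1 <= i)%N ->
  a != 0 -> c != 0 -> (size c <= p ^ s)%N -> ('X - a%:P) ^+ i %| c ->
  (Gamma.+1 * p ^ gamma <= hwt c)%N.
Proof.
move=> lt_gs Gamma_bd le_i nz_a;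
  elim: gamma s i c lt_gs le_i => [|gamma IH] [|s] //
  i c lt_gs le_i nz_c size_c dvd_i.
all: rewrite expnS in size_c.
all: have [k [r /and4P[lt_kp nz_r size_r le_wt] /(_ _ dvd_i) dvd_r]] :=
  hwt_reduction nz_a nz_c size_c.
all: have lt_ik: (i - k * p ^ s < p ^ s)%N
  by have := dvdp_leq nz_r dvd_r; rewrite size_exp_XsubC => /leq_trans->.
- rewrite expn0 muln1; rewrite subn0 subnn add0n !subn1 /= in le_i.
  have q_gt0 : (0 < p ^ s)%N by rewrite expn_gt0 p_gt0.
  have [le_Gk|lt_kG] := leqP Gamma k.
    by rewrite (leq_trans _ le_wt) //
      (leq_trans _ (leq_pmulr _ (hwt_gt0 nz_r))).
  (* The leftover multiplicity is then positive, so [r] has the root [a] and at least two terms;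
     [2 * Gamma >= Gamma + 1] suffices. *)
  have kE : k = Gamma.-1 by nia.
  rewrite (leq_trans _ le_wt) //.
  have : (1 < hwt r)%N.
    apply: (hwt_mul_root_gt1 nz_a nz_r); apply: dvdp_trans dvd_r.
    by rewrite -{1}[_ - _]expr1 dvdp_exp2l //; nia.
  nia.
rewrite (leq_trans _ le_wt) //.
have q_gt0 : (0 < p ^ s)%N by rewrite expn_gt0 p_gt0.
rewrite subSS in le_i.
have le_pq : (p ^ (s - gamma) <= p ^ s)%N by rewrite leq_pexp2l // leq_subr.
(* Here [i] exceeds [(p - 1) * p ^ s], and the leftover multiplicity is below [p ^ s]. *)
have kE : k = p.-1.
  rewrite expnS in le_i; nia.
rewrite expnSr mulnA mulnC kE prednK // leq_mul //.
apply: (IH s _ _ _ _ nz_r size_r dvd_r) => //.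
rewrite expnS -{1}(prednK p_gt0) mulSn in le_i; rewrite kE; lia.
Qed.

(** With [e = s - gamma - 1], the exponent is [p ^ e * (p * (p ^ gamma - 1) + Gamma)]. Up to
    substituting [X^(p^e)] for [X], the power is a polynomial in [X^p] with at most [p ^ gamma]
    terms times one of degree [Gamma]. *)
Lemma hwt_XsubC_exp_le s gamma Gamma a : (gamma < s)%N ->
  (hwt (('X - a%:P) ^+ (p ^ s - p ^ (s - gamma) + Gamma * p ^ (s - gamma - 1)))
   <= Gamma.+1 * p ^ gamma)%N.
Proof.
move=> lt_gs; have [e sE] : exists e, s = (gamma + e.+1)%N
  by exists (s - gamma.+1)%N; lia.
rewrite sE addKn subSS subn0.
have -> : (p ^ (gamma + e.+1) - p ^ e.+1 + Gamma * p ^ e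
           = p ^ e * (p ^ 1 * (p ^ gamma).-1 + Gamma))%N.
  rewrite expnD -{1}[(p ^ gamma)%N]prednK ?expn_gt0 ?p_gt0 //
    mulSn addKn expn1 expnS mulnDr; nia.
rewrite exprM XsubC_exp_pchar -rmorphXn /= hwt_comp_Xn ?expn_gt0 ?p_gt0 //.
rewrite exprD exprM XsubC_exp_pchar -rmorphXn /= mulnC.
apply: leq_trans (hwtM _ _) _; rewrite hwt_comp_Xn ?expn_gt0 ?p_gt0 //
  leq_mul //.
  by rewrite (leq_trans (hwt_le_size _)) // size_exp_XsubC prednK //
    expn_gt0 p_gt0.
by rewrite (leq_trans (hwt_le_size _)) // size_exp_XsubC.
Qed.
End RepeatedRootBound.

(** * The ring R_alpha *)

Section DualNumbers.
Variable A : comNzRingType.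
Local Notation D := {poly %/ ('X^2 : {poly A})}.

Lemma polyn_dualX : ('qX : D) = 'X :> {poly A}.
Proof. by rewrite qpolyXE ?size_polyXn ?monicXn. Qed.

Lemma dualX_sqr : ('qX : D) ^+ 2 = 0.
Proof.
rewrite -rmorphXn /=; apply/val_inj => /=.
by rewrite mk_monic_Xn Pdiv.RingMonic.rmodpp ?monicXn.
Qed.

Lemma dual_polyn (a b : A) :
  (qpolyC _ a + qpolyC _ b * 'qX : D) = a%:P + b *: 'X :> {poly A}.
Proof.
rewrite poly_of_qpolyD; congr (_ + _).
rewrite poly_of_qpolyM polyn_dualX /= mul_polyC Pdiv.CommonRing.rmodp_small //.
by rewrite mk_monic_Xn size_polyXn (leq_ltn_trans (size_scale_leq _ _)) //
  size_polyX.
Qed.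

Lemma dual_expand (r : D) :
  r = qpolyC _ (polyn r)`_0 + qpolyC _ (polyn r)`_1 * 'qX.
Proof.
apply/val_inj; rewrite [RHS]dual_polyn; apply/polyP => i.
rewrite coefD coefC coefZ coefX; case: i => [|[|i]] /=.
- by rewrite mulr0 addr0.
- by rewrite mulr1 add0r.
by rewrite mulr0 addr0 nth_default // (leq_trans (size_npoly r)) //
  mk_monic_Xn size_polyXn.
Qed.

Lemma dualX_inj (a : A) : (qpolyC _ a * 'qX : D) = 0 -> a = 0.
Proof.
move=> a0; have /(congr1 (fun P : {poly A} => P`_1)) := dual_polyn 0 a.
by rewrite qpolyC0 add0r a0 coef0 coefD coefC coefZ coefX mulr1 add0r.
Qed.
End DualNumbers.

Section RuvTheory.
Variable F : finFieldType.
Implicit Types a b : F.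

Fact constF_is_zmod_morphism : zmod_morphism (@constF F).
Proof. by move=> a b; rewrite /constF !rmorphB. Qed.
Fact constF_is_monoid_morphism : monoid_morphism (@constF F).
Proof. by split=> [|a b]; rewrite /constF ?rmorph1 ?rmorphM. Qed.
HB.instance Definition _ := GRing.isZmodMorphism.Build F (Ruv F) (@constF F)
  constF_is_zmod_morphism.
HB.instance Definition _ := GRing.isMonoidMorphism.Build F (Ruv F) (@constF F)
  constF_is_monoid_morphism.

Lemma uR_sqr : (uR : Ruv F) ^+ 2 = 0.
Proof. by rewrite -rmorphXn /= dualX_sqr rmorph0. Qed.

Lemma vR_sqr : (vR : Ruv F) ^+ 2 = 0.
Proof. exact: dualX_sqr. Qed.

Lemma Ruv_expand (r : Ruv F) : exists a b c d : F,
  r = constF a + constF b * uR + (constF c + constF d * uR) * vR.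
Proof.
rewrite (dual_expand r).
set r0 := (polyn r)`_0; set r1 := (polyn r)`_1.
exists (polyn r0)`_0, (polyn r0)`_1, (polyn r1)`_0, (polyn r1)`_1.
by rewrite {1}(dual_expand r0) {1}(dual_expand r1) !rmorphD !rmorphM.
Qed.

(** The factor [vR] is cancelled over F[u], then the factor [uR] over F. *)
Lemma constF_uv_eq0 a : constF a * (uR * vR) = 0 -> a = 0.
Proof.
move=> a0; apply: dualX_inj; apply: dualX_inj.
by rewrite -[RHS]a0 rmorphM mulrA.
Qed.
End RuvTheory.

(** * Codewords killed by u, in an abstract presentation of the ring *)

Section NilpotentPresentation.
Variables (F : fieldType) (A : comNzRingType) (iota : {rmorphism {poly F} ->
  A}).
Variables (U V : A) (Q : {poly F}) (N n : nat) (alpha3 alpha4 : F).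
Hypotheses (U_sqr : U ^+ 2 = 0) (V_sqr : V ^+ 2 = 0) (alpha3_neq0 : alpha3 !=
  0).
Hypothesis iota_QN : iota (Q ^+ N) = V * (iota alpha3%:P + U * iota alpha4%:P).
Hypothesis Q_neq0 : Q != 0.
Hypothesis size_QN : size (Q ^+ N) = n.+1.
Hypothesis A_expand : forall c : A, exists P0 P1 P2 P3,
  c = iota P0 + U * iota P1 + V * (iota P2 + U * iota P3).
Hypothesis uv_iota_eq0 : forall P : {poly F}, (size P <= n)%N ->
  U * V * iota P = 0 -> P = 0.

Let iota_alpha3K : iota alpha3%:P * iota (alpha3^-1)%:P = 1.
Proof. by rewrite -rmorphM -polyCM divff // rmorph1. Qed.

(** The second factor is the inverse of [alpha3 + alpha4 U], a two-term geometric series because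
    [U ^+ 2 = 0]. *)
Lemma V_iota : V = iota (Q ^+ N)
  * (iota (alpha3^-1)%:P - U * iota (alpha4 / alpha3 ^+ 2)%:P).
Proof.
have -> : (alpha4 / alpha3 ^+ 2)%:P = alpha4%:P * (alpha3^-1)%:P ^+ 2.
  by rewrite -polyC_exp -polyCM exprVn.
rewrite iota_QN rmorphM rmorphXn.
move: (iota _) (iota (_^-1)%:P) (iota alpha4%:P) iota_alpha3K => a b d K.
(* The terms are regrouped so that [a * b] and [U ^+ 2] appear literally and can be rewritten; the
   later uses of [transitivity] before [ring] serve the same purpose. *)
transitivity (V * (a * b) * (1 - U ^+ 2 * d ^+ 2 * b ^+ 2)
   + V * U * d * b * (1 - a * b) + V * U ^+ 2 * d ^+ 2 * b ^+ 2 * (a * b -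
     1)); last by ring.
by rewrite K U_sqr; ring.
Qed.

Lemma A_uexpand (c : A) : exists P0 P1, c = iota P0 + U * iota P1.
Proof.
have [P0 [P1 [P2 [P3 ->]]]] := A_expand c.
set a := (alpha3^-1)%:P; set b := (alpha4 / alpha3 ^+ 2)%:P.
(* The witnesses come from substituting [V = Q^N (a - U b)] and dropping the term in [U ^+ 2]. *)
exists (P0 + Q ^+ N * a * P2), (P1 + Q ^+ N * (a * P3 - b * P2)).
rewrite [in LHS]V_iota -/a -/b !(rmorphB, rmorphD, rmorphM).
move: (iota (Q ^+ N)) (iota a) (iota b) (iota _) (iota P1) (iota P2) (iota P3).
move=> q a' b' p0 p1 p2 p3.
transitivity (p0 + U * p1 + q * a' * p2 + U * q * (a' * p3 - b' * p2)
   - q * U ^+ 2 * b' * p3); first by ring.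
by rewrite U_sqr; ring.
Qed.

Lemma iota_Q2N : iota (Q ^+ (2 * N)) = 0.
Proof. by rewrite mulnC exprM rmorphXn /= iota_QN exprMn V_sqr mul0r. Qed.

(** Expand [P] in base [Q ^+ N]: only the digits [P2] and [P1] survive under [iota], and each is
    shown to vanish by isolating it behind [U * V]. *)
Lemma u_iota_eq0 (P : {poly F}) : U * iota P = 0 -> Q ^+ (2 * N) %| P.
Proof.
move=> P0.
have nz_QN : Q ^+ N != 0 by rewrite -size_poly_gt0 size_QN.
pose P2 := P %% Q ^+ N; pose P1 := (P %/ Q ^+ N) %% Q ^+ N.
pose h := (P %/ Q ^+ N) %/ Q ^+ N.
have s1 : (size P1 <= n)%N by rewrite -ltnS -size_QN ltn_modp.
have s2 : (size P2 <= n)%N by rewrite -ltnS -size_QN ltn_modp.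
have PE : P = h * Q ^+ (2 * N) + P1 * Q ^+ N + P2.
  rewrite {1}(divp_eq P (Q ^+ N)) {1}(divp_eq (P %/ Q ^+ N) (Q ^+ N)).
  by rewrite mul2n -addnn exprD mulrA mulrDl.
have ip : iota P = iota P1 * (V * (iota alpha3%:P + U * iota alpha4%:P)) +
  iota P2.
  by rewrite PE !rmorphD !rmorphM /= iota_Q2N -iota_QN mulr0 add0r.
(* Multiplication by [V] kills the term of [P1], which already contains [V]. *)
have P20 : P2 = 0.
  apply: uv_iota_eq0 => //.
  transitivity (V * (U * iota P) - V ^+ 2 * U * iota P1 * (iota alpha3%:P + U
    * iota alpha4%:P)).
    by rewrite ip; ring.
  by rewrite P0 V_sqr; ring.
(* Now [U] kills the [alpha4] term, and [alpha3] is invertible. *)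
have P10 : P1 = 0.
  apply: uv_iota_eq0 => //; rewrite -[LHS]mulr1 -iota_alpha3K.
  transitivity (iota (alpha3^-1)%:P * (U * iota P)
      - U ^+ 2 * V * iota (alpha3^-1)%:P * iota P1 * iota alpha4%:P).
    by rewrite ip P20 rmorph0; ring.
  by rewrite P0 U_sqr; ring.
by rewrite PE P20 P10 mul0r !addr0 dvdp_mull.
Qed.

(** Write [a = P0 + U P1]. The condition [U * c = 0] forces [P0] to cancel [f ^+ l], so every
    surviving term of [c] contains [U]. The minimality of [tor] then shows that each of these terms
    is divisible by [U * f ^+ mu]. *)
Lemma torsion_code (f g z c a b : A) (l t mu tor : nat) :
  f = iota Q -> g = f ^+ l + U * f ^+ t * z ->
  (z = 0 \/ exists w, z * w = 1) -> (l <= 2 * N)%N -> (mu < tor)%N ->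
  (forall j d, U * f ^+ j = d * g -> (tor <= j)%N) ->
  c = a * g + b * (U * f ^+ mu) -> U * c = 0 ->
  exists P, c = U * iota (Q ^+ mu * P).
Proof.
move=> fE gE z_unit le_l lt_mu tor_min cE uc0.
suff [e ->] : exists e, c = U * f ^+ mu * e.
  have [P0 [P1 ->]] := A_uexpand e; exists P0.
  rewrite rmorphM rmorphXn mulrDr /= -fE.
  transitivity (U * (f ^+ mu * iota P0) + U ^+ 2 * f ^+ mu * iota P1);
    first by ring.
  by rewrite U_sqr mul0r mul0r addr0.
(* Since [U * g = U * f ^+ l], minimality gives [tor <= l]. *)
have le_mul : (mu <= l)%N.
  rewrite (leq_trans (ltnW lt_mu)) // (tor_min l U) // gE.
  transitivity (U * f ^+ l + U ^+ 2 * f ^+ t * z); last by ring.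
  by rewrite U_sqr !mul0r addr0.
have [P0 [P1 aE]] := A_uexpand a.
have dvd_P0 : Q ^+ (2 * N - l) %| P0.
  have /u_iota_eq0 : U * iota (P0 * Q ^+ l) = 0.
    rewrite rmorphM rmorphXn /= -fE -uc0 cE aE gE.
    transitivity (U * (iota P0 * f ^+ l) + U ^+ 2 * (iota P1 * (f ^+ l + U * f
      ^+ t * z)
       + iota P0 * f ^+ t * z + b * f ^+ mu)); last by ring.
    by rewrite U_sqr mul0r addr0.
  by rewrite -{1}(subnK le_l) exprD dvdp_mul2r // expf_neq0.
have [h P0E] := dvdpP _ _ dvd_P0.
have f2N : f ^+ (2 * N - l) * f ^+ l = 0.
  by rewrite -exprD subnK // fE -rmorphXn /= iota_Q2N.
have [e eE] : exists e, U * f ^+ (2 * N - l) * f ^+ t * z = U * f ^+ mu * e.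
  case: z_unit => [->|[w zw]]; first by exists 0; rewrite !mulr0.
  (* Multiplying [g] by [f ^+ (2 * N - l)] kills its first term; the inverse [w] of [z] then clears
     the second. *)
  have le_tor : (tor <= 2 * N - l + t)%N.
    apply: (tor_min _ (w * f ^+ (2 * N - l))); rewrite gE exprD.
    transitivity (w * (f ^+ (2 * N - l) * f ^+ l)
      + U * (f ^+ (2 * N - l) * f ^+ t) * (z * w)); last by ring.
    by rewrite f2N zw; ring.
  exists (f ^+ (2 * N - l + t - mu) * z).
  by rewrite mulrA -[_ * f ^+ mu * _]mulrA -exprD subnKC ?exprD ?mulrA //
    (leq_trans (ltnW lt_mu)).
exists (iota h * e + iota P1 * f ^+ (l - mu) + b).
have fl : f ^+ l = f ^+ mu * f ^+ (l - mu) by rewrite -exprD subnKC.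
rewrite cE aE P0E rmorphM rmorphXn /= -fE gE.
transitivity (iota h * (f ^+ (2 * N - l) * f ^+ l) + iota h * (U * f ^+ (2 * N
  - l) * f ^+ t * z)
  + U * iota P1 * f ^+ l + U ^+ 2 * iota P1 * f ^+ t * z + b * (U * f ^+ mu)).
  by ring.
by rewrite f2N eE U_sqr fl; ring.
Qed.

Lemma u_iota_QN (P : {poly F}) :
  U * iota (Q ^+ N * P) = U * V * iota alpha3%:P * iota P.
Proof.
rewrite rmorphM /= iota_QN.
transitivity (U * V * iota alpha3%:P * iota P + U ^+ 2 * V * iota alpha4%:P *
  iota P).
  by ring.
by rewrite U_sqr !mul0r addr0.
Qed.

(** Extracting [Q ^+ N] turns [U] into [U * V] up to [alpha3], and the cofactor matters only modulo
    [Q ^+ N]. As [mu - N <= N], the remainder keeps the factor [Q ^+ (mu - N)]. *)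
Lemma torsion_code_high (mu : nat) (P : {poly F}) : (N <= mu <= 2 * N)%N ->
  exists2 P', (Q ^+ (mu - N) %| P') && (size P' <= n)%N &
    U * iota (Q ^+ mu * P) = U * V * iota alpha3%:P * iota P'.
Proof.
move=> /andP[le_Nmu le_mu].
pose P' := Q ^+ (mu - N) * P; exists (P' %% Q ^+ N).
  rewrite -[(_ <= n)%N]ltnS -size_QN ltn_modp expf_neq0 // andbT.
  by rewrite -(@dvdp_mod _ _ (Q ^+ N)) ?dvdp_mulr // dvdp_exp2l //
    leq_subLR addnn -mul2n.
rewrite -u_iota_QN -(subnKC le_Nmu) exprD -mulrA -/P'.
rewrite {1}(divp_eq P' (Q ^+ N)) mulrDr rmorphD mulrDr mulrCA -expr2 -exprM.
by rewrite [in X in X + _]rmorphM mulnC iota_Q2N !mulr0 add0r.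
Qed.
End NilpotentPresentation.

(** * Symbol-pair weight *)

Section PairWeight.
Variable n : nat.
Implicit Types S T : {set 'I_n}.

(** The positions whose pair of consecutive entries meets [S]; position i reads i and i + 1, hence a
    preimage of the shift. *)
Definition pair_support S := S :|: @ordS n @^-1: S.

Lemma dsp_pair_support (A : eqType) (x y : 'rV[A]_n) :
  dsp x y = #|pair_support [set i | x ord0 i != y ord0 i]|.
Proof.
by apply: eq_card => i; rewrite !inE xpair_eqE negb_and.
Qed.

Lemma card_pair_support_le S : (#|pair_support S| <= 2 * #|S|)%N.
Proof.
rewrite cardsU (leq_trans (leq_subr _ _)) // mul2n -addnn leq_add2l.
by rewrite on_card_preimset //; apply: onW_bij; exact: ordS_bij.
Qed.

Lemma pair_supportS S T : S \subset T -> pair_support S \subset pair_support T.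
Proof. by move=> sST; rewrite setUSS // preimsetS. Qed.

Lemma bigminn_le (I : eqType) (r : seq I) (P : pred I) (f : I -> nat) x :
  x \in r -> P x -> (\big[minn/n]_(i <- r | P i) f i <= f x)%N.
Proof.
elim: r => // y r IH; rewrite inE big_cons => /predU1P[<-|xr] Px.
  by rewrite Px geq_minl.
by case: ifP => _; rewrite ?geq_min IH ?orbT.
Qed.

Lemma dsp_code_eq (A : finType) (C : {set 'rV[A]_n}) d x y :
  x \in C -> y \in C -> x != y -> (dsp x y <= d)%N ->
  {in C &, forall x y, x != y -> (d <= dsp x y)%N} -> dsp_code C = d.
Proof.
move=> Cx Cy neq_xy le_d ge_d.
(* Both nested minima start from the default [n], so the lower bound must hold for [n] as well. *)
have dn : (d <= n)%N.
  by rewrite (leq_trans (ge_d _ _ Cx Cy neq_xy)) // -[leqRHS]card_ord max_card.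
apply/eqP; rewrite eqn_leq; apply/andP; split.
  apply: leq_trans le_d; rewrite /dsp_code.
  apply: leq_trans (bigminn_le _ (mem_index_enum x) Cx) _.
  by apply: (bigminn_le (dsp x) (mem_index_enum y)); rewrite Cy.
rewrite /dsp_code; elim/big_rec: _ => // x' m Cx' le_m;
  rewrite leq_min le_m andbT.
elim/big_rec: _ => // y' m' /andP[Cy' neq'] le_m'; rewrite leq_min le_m' andbT.
exact: ge_d.
Qed.
End PairWeight.

Section EvenLength.
Variables (N : nat).
Implicit Types S : {set 'I_(2 * N)}.

(** The wrap-around subtracts a multiple of the even length and so respects parity. *)
Lemma odd_ordS (i : 'I_(2 * N)) : odd (ordS i) = ~~ odd i.
Proof.
rewrite /= -[in RHS]/(odd i.+1) {2}(divn_eq i.+1 (2 * N)) oddD oddM oddM andbF.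
by [].
Qed.

(* Shifting by one exchanges even and odd positions, so a set of positions of
   one parity and its shift are disjoint. *)
Lemma card_pair_support_ge (b : bool) S :
  (2 * #|[set i in S | odd i == b]| <= #|pair_support S|)%N.
Proof.
set T := [set i in S | odd i == b].
have sTS : T \subset S by apply/subsetP => i; rewrite inE => /andP[].
apply: leq_trans (subset_leq_card (pair_supportS sTS)).
have disj : [disjoint T & @ordS _ @^-1: T].
  rewrite -setI_eq0; apply/eqP/setP => i; rewrite in_set0 in_setI !inE.
  rewrite odd_ordS; have [<-|] := eqVneq (odd i) b; last by rewrite andbF.
  by case: (odd i); rewrite !andbF.
rewrite /pair_support cardsU (disjoint_setI0 disj) cards0 subn0
  on_card_preimset ?mul2n ?addnn //.
by apply: onW_bij; exact: ordS_bij.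
Qed.

Lemma pair_support_gt1 S : S != set0 -> (2 <= #|pair_support S|)%N.
Proof.
case/set0Pn => i Si; apply: leq_trans (card_pair_support_ge (odd i) S).
by rewrite -{1}[2%N]muln1 leq_mul2l /= card_gt0; apply/set0Pn; exists i;
  rewrite inE Si eqxx.
Qed.

(** The section with index [b], read as 0 or 1, lists the entries at the positions [i * 2 + b], all
    of one parity. *)
Lemma hwt_section_pair_support (R : comNzRingType) (P : {poly R}) (b : bool) :
  (size P <= 2 * N)%N ->
  (2 * hwt (section_poly 2 b P) <= #|pair_support [set i : 'I_(2 * N) | (P`_i
    != 0)%R]|)%N.
Proof.
move=> le_P; apply: leq_trans (card_pair_support_ge b _); rewrite leq_mul2l /=.
have size_s : (size (section_poly 2 b P) <= N)%N
  by rewrite size_section_poly // mulnC.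
have lt_f (i : 'I_N) : (i * 2 + b < 2 * N)%N by case: b {size_s} => /=;
  have := ltn_ord i; lia.
pose f i := Ordinal (lt_f i).
have f_inj : injective f by move=> i j /(congr1 val) /= ?;
  apply/val_inj => /=; lia.
rewrite (hwtE size_s) -big_mkcond sum1_card.
rewrite -(card_imset _ f_inj) subset_leq_card //;
  apply/subsetP => _ /imsetP[i + ->].
by rewrite !inE unfold_in coef_section_poly //= => ->;
  rewrite oddD oddM andbF oddb eqxx.
Qed.

(** Some parity section of [P] is nonzero. As [X^2 - a] is [X - a] evaluated at [X^2], that section
    inherits the factor [('X - a%:P) ^+ i]. *)
Lemma pair_support_repeated_root (F : fieldType) p s gamma Gamma i (a : F) (P
  : {poly F}) :
  p \in [pchar F] -> N = (p ^ s)%N -> (gamma < s)%N -> (1 <= Gamma <= p - 1)%N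
    ->
  (p ^ s - p ^ (s - gamma) + (Gamma - 1) * p ^ (s - gamma - 1) + 1 <= i)%N ->
  a != 0 -> P != 0 -> (size P <= 2 * N)%N -> ('X^2 - a%:P) ^+ i %| P ->
  (2 * Gamma.+1 * p ^ gamma <= #|pair_support [set i : 'I_(2 * N) | (P`_i !=
    0)%R]|)%N.
Proof.
move=> pcharF NE lt_gs Gamma_bd le_i nz_a nz_P le_P dvd_P.
have [b nz_b] : exists b : bool, section_poly 2 b P != 0.
  have := hwt_gt0 nz_P; rewrite (hwt_section _ (isT : (0 < 2)%N))
    !big_ord_recl big_ord0 addn0.
  have [->|? _] := eqVneq (section_poly 2 (@ord0 1) P) 0; last by exists false.
  rewrite hwt0 add0n => gt0; exists true.
  by apply: contraTneq gt0 => s0; rewrite s0 hwt0.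
apply: leq_trans (hwt_section_pair_support b le_P); rewrite -mulnA leq_mul2l /=.
apply: (hwt_repeated_root pcharF lt_gs Gamma_bd le_i nz_a nz_b).
  by rewrite -NE size_section_poly // mulnC.
have [P' ->] := dvdpP _ _ dvd_P.
have -> : 'X^2 - a%:P = ('X - a%:P) \Po 'X^2
  by rewrite comp_polyB comp_polyX comp_polyC.
by rewrite mulrC -rmorphXn /= section_poly_comp ?dvdp_mulr //; case: b {nz_b}.
Qed.
End EvenLength.

(** The Horner step of [Ra_expand], as an identity valid in every commutative ring. *)
Lemma nilpotent_coords_mulX (A : comNzRingType) (u v x p0 p1 p2 p3 a b d e :
  A) :
  (p0 + u * p1 + v * (p2 + u * p3)) * x + (a + b * u + (d + e * u) * v)
  = p0 * x + a + u * (p1 * x + b) + v * (p2 * x + d + u * (p3 * x + e)).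
Proof. by ring. Qed.

(** * Representatives and supports in the concrete quotient *)

Section Constacyclic.
Variables (F : finFieldType) (n : nat) (alpha : Ruv F).
Hypothesis n_gt0 : (0 < n)%N.
Local Notation Ra := (Rconst n alpha).

Lemma size_XnsubC_alpha : size ('X^n - alpha%:P) = n.+1.
Proof.
by rewrite size_polyDl size_polyXn //
  size_polyN ltnS (leq_trans (size_polyC_leq1 _)).
Qed.

(** The quotient is taken modulo [mk_monic], which replaces a constant or non-monic polynomial by
    ['X]; positivity of [n] rules this out. *)
Lemma mk_monic_Ra : mk_monic ('X^n - alpha%:P) = 'X^n - alpha%:P.
Proof.
rewrite /mk_monic size_XnsubC_alpha ltnS n_gt0 monicE lead_coefE
  size_XnsubC_alpha.
by rewrite coefB coefXn coefC eqxx gtn_eqF // subr0 eqxx.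
Qed.

Definition iota_poly (P : {poly F}) : Ra := in_qpoly _ (map_poly (@constF F) P).

Fact iota_poly_is_zmod_morphism : zmod_morphism iota_poly.
Proof. by move=> P Q; rewrite /iota_poly !rmorphB. Qed.
Fact iota_poly_is_monoid_morphism : monoid_morphism iota_poly.
Proof. by split=> [|P Q]; rewrite /iota_poly ?rmorph1 ?rmorphM. Qed.
HB.instance Definition _ := GRing.isZmodMorphism.Build {poly F} Ra iota_poly
  iota_poly_is_zmod_morphism.
HB.instance Definition _ := GRing.isMonoidMorphism.Build {poly F} Ra iota_poly
  iota_poly_is_monoid_morphism.

Fact toRa_is_zmod_morphism : zmod_morphism (@toRa F n alpha).
Proof. by move=> a b; rewrite /toRa rmorphB. Qed.
Fact toRa_is_monoid_morphism : monoid_morphism (@toRa F n alpha).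
Proof. by split=> [|a b]; rewrite /toRa ?rmorph1 ?rmorphM. Qed.
HB.instance Definition _ := GRing.isZmodMorphism.Build (Ruv F) Ra (@toRa F n
  alpha)
  toRa_is_zmod_morphism.
HB.instance Definition _ := GRing.isMonoidMorphism.Build (Ruv F) Ra (@toRa F n
  alpha)
  toRa_is_monoid_morphism.

Lemma iota_polyD : {morph iota_poly : P Q / P + Q}. Proof. exact: rmorphD. Qed.
Lemma iota_polyM : {morph iota_poly : P Q / P * Q}. Proof. exact: rmorphM. Qed.
Lemma iota_polyB : {morph iota_poly : P Q / P - Q}. Proof. exact: rmorphB. Qed.
Lemma iota_polyXn k : {morph iota_poly : P / P ^+ k}. Proof. exact: rmorphXn.
  Qed.
Lemma toRaD : {morph (@toRa F n alpha) : a b / a + b}. Proof. exact: rmorphD.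
  Qed.
Lemma toRaM : {morph (@toRa F n alpha) : a b / a * b}. Proof. exact: rmorphM.
  Qed.

Lemma iota_polyX : iota_poly 'X = xRa.
Proof. by rewrite /iota_poly map_polyX. Qed.

Lemma toRaE (a : Ruv F) : toRa a = in_qpoly _ a%:P :> Ra.
Proof. by apply/val_inj; rewrite /= Pdiv.CommonRing.rmodp_small //
  mk_monic_Ra size_XnsubC_alpha ltnS (leq_trans (size_polyC_leq1 _)). Qed.

Lemma iota_polyC a : iota_poly a%:P = toRa (constF a).
Proof. by rewrite /iota_poly map_polyC toRaE. Qed.

Lemma xRa_exp : xRa ^+ n = toRa alpha :> Ra.
Proof.
rewrite toRaE /xRa -rmorphXn; apply/eqP; rewrite -subr_eq0 -rmorphB /=.
apply/eqP/val_inj => /=; rewrite mk_monic_Ra Pdiv.RingMonic.rmodpp //.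
by rewrite -mk_monic_Ra monic_mk_monic.
Qed.

Lemma polyn_toRaM (r : Ruv F) (c : Ra) : toRa r * c = r *: (c : {poly Ruv F})
  :> {poly Ruv F}.
Proof.
rewrite poly_of_qpolyM /= mul_polyC Pdiv.CommonRing.rmodp_small //.
by rewrite (leq_ltn_trans (size_scale_leq _ _)) // size_mk_monic.
Qed.

Lemma polyn_iota (P : {poly F}) : (size P <= n)%N -> iota_poly P = map_poly
  (@constF F) P :> {poly Ruv F}.
Proof.
move=> le_P; apply: in_qpoly_small.
by rewrite mk_monic_Ra size_XnsubC_alpha ltnS (leq_trans (size_poly _ _)).
Qed.

Lemma coef_toRa_iota (r : Ruv F) (P : {poly F}) i : (size P <= n)%N ->
  (polyn (toRa r * iota_poly P))`_i = r * constF P`_i.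
Proof. by move=> le_P; rewrite polyn_toRaM polyn_iota // coefZ coef_map. Qed.

Local Notation U := (toRa uR : Ra).
Local Notation V := (toRa vR : Ra).

Lemma uv_iota_eq0 (P : {poly F}) : (size P <= n)%N -> U * V * iota_poly P = 0
  -> P = 0.
Proof.
move=> le_P; rewrite -toRaM => P0; apply/polyP => i; rewrite coef0.
by apply: constF_uv_eq0; rewrite mulrC -coef_toRa_iota // P0 coef0.
Qed.

Lemma Ra_expand (c : Ra) : exists P0 P1 P2 P3,
  c = iota_poly P0 + U * iota_poly P1 + V * (iota_poly P2 + U * iota_poly P3).
Proof.
have cE : c = in_qpoly _ (polyn c).
  by apply/val_inj; rewrite /= Pdiv.CommonRing.rmodp_small // size_mk_monic.
rewrite cE; elim/poly_ind: (polyn c) => [|P r [P0 [P1 [P2 [P3 IH]]]]].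
  by exists 0, 0, 0, 0; rewrite !rmorph0 !(mulr0, addr0).
have [a [b [d [e rE]]]] := Ruv_expand r.
rewrite in_qpolyD in_qpolyM IH -toRaE rE -[in_qpoly _ 'X]/(xRa : Ra)
  -iota_polyX.
exists (P0 * 'X + a%:P), (P1 * 'X + b%:P), (P2 * 'X + d%:P), (P3 * 'X + e%:P).
rewrite !iota_polyD !iota_polyM !iota_polyC !toRaD !toRaM !toRaD !toRaM.
exact: nilpotent_coords_mulX.
Qed.


(** The shape of [alpha] enters here, through [x^n = alpha]; this supplies the hypothesis [iota_QN]
    of the abstract presentation. *)
Lemma iota_Xn_sub_const alpha1 alpha3 alpha4 :
  alpha = constF alpha1 + constF alpha3 * vR + constF alpha4 * uR * vR ->
  iota_poly ('X^n - alpha1%:P) = V * (iota_poly alpha3%:P + U * iota_poly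
    alpha4%:P).
Proof.
move=> alphaE; rewrite iota_polyB iota_polyXn iota_polyX xRa_exp !iota_polyC.
rewrite [X in toRa X - _]alphaE.
rewrite !toRaD !toRaM.
have regroup (A : comNzRingType) (a b d v w : A) :
  a + b * w + d * v * w - a = w * (b + v * d) by ring.
exact: regroup.
Qed.

Definition word_support (c : Ra) := [set i : 'I_n | (polyn c)`_i != 0].

Lemma dsp_word_of (c d : Ra) :
  dsp (word_of c) (word_of d) = #|pair_support (word_support (c - d))|.
Proof.
rewrite dsp_pair_support; congr #|pair_support _|; apply/setP => i.
by rewrite !inE !mxE -subr_eq0 -coefB.
Qed.

Lemma word_of_inj : injective (@word_of _ n alpha).
Proof.
move=> c d /rowP cd; apply/val_inj/polyP => i /=.
have [lt_i|le_i] := ltnP i n; first by have := cd (Ordinal lt_i); rewrite !mxE.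
have sz (e : Ra) : (size (polyn e) <= i)%N.
  by rewrite (leq_trans _ le_i) // (leq_trans (size_npoly e)) //
    mk_monic_Ra size_XnsubC_alpha.
by rewrite !nth_default.
Qed.

Lemma word_support_neq0 (c : Ra) : c != 0 -> word_support c != set0.
Proof.
apply: contra_neq => /setP c0; apply: word_of_inj; apply/rowP => i.
by have := c0 i; rewrite !inE !mxE coef0 => /negbFE/eqP.
Qed.

Lemma word_support_toRaM r (c : Ra) : word_support (toRa r * c) \subset
  word_support c.
Proof.
apply/subsetP => i; rewrite !inE polyn_toRaM coefZ.
by apply: contra_neq => ->; rewrite mulr0.
Qed.

(** This turns supports of words over the ring into supports of polynomials over the field. *)
Lemma word_support_uv_iota a (P : {poly F}) : a != 0 -> (size P <= n)%N ->
  word_support (U * V * iota_poly a%:P * iota_poly P) = [set i : 'I_n | P`_i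
    != 0].
Proof.
move=> nz_a le_P; rewrite iota_polyC -!toRaM; apply/setP => i.
rewrite !inE coef_toRa_iota //; congr negb; apply/eqP/eqP => [P0|->].
  have /constF_uv_eq0/eqP : constF (a * P`_i) * (uR * vR) = 0.
    by rewrite rmorphM mulrC mulrA.
  by rewrite mulf_eq0 (negPf nz_a) => /eqP.
by rewrite rmorph0 mulr0.
Qed.
End Constacyclic.

(** Subtracting [p ^ s] from [mu] gives the exponent of the code over the field; its range ends at
    [E Gamma], which stays below [p ^ s] because [Gamma < p]. *)
Lemma exponent_bounds p s gamma Gamma mu : (0 < p)%N -> (0 < s)%N ->
  (1 <= Gamma <= p - 1)%N -> (0 <= gamma <= s - 1)%N ->
  (2 * p ^ s - p ^ (s - gamma) + (Gamma - 1) * p ^ (s - gamma - 1) + 1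
     <= mu
     <= 2 * p ^ s - p ^ (s - gamma) + Gamma * p ^ (s - gamma - 1))%N ->
  let E j := (p ^ s - p ^ (s - gamma) + j * p ^ (s - gamma - 1))%N in
  [/\ gamma < s, E Gamma < p ^ s, mu <= p ^ s + E Gamma, p ^ s <= mu
    & E (Gamma - 1) + 1 <= mu - p ^ s]%N.
Proof.
move=> p_gt0 s_gt0 Gamma_bd gamma_bd mu_bd E.
have lt_gs : (gamma < s)%N by lia.
have q_gt0 : (0 < p ^ (s - gamma - 1))%N by rewrite expn_gt0 p_gt0.
have qE : (p ^ (s - gamma) = p * p ^ (s - gamma - 1))%N.
  by rewrite -expnS; congr expn; lia.
have le_q : (p ^ (s - gamma) <= p ^ s)%N by rewrite leq_pexp2l // leq_subr.
have lt_q : (Gamma * p ^ (s - gamma - 1) < p ^ (s - gamma))%N.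
  by rewrite qE ltn_pmul2r //; lia.
by split; rewrite /E; lia.
Qed.

(** * The symbol-pair distance of the code *)

Theorem theorem5p7
  (F : finFieldType) (p m s : nat)
  (p_prime : prime p) (p_odd : odd p) (m_gt0 : (0 < m)%N) (s_gt0 : (0 < s)%N)
  (cardF : #|F| = (p ^ m)%N)
  (alpha1 alpha3 alpha4 : F)
  (alpha1_neq0 : alpha1 != 0) (alpha3_neq0 : alpha3 != 0)
  (alpha4_neq0 : alpha4 != 0)
  (alpha : Ruv F)
  (alphaE : alpha = constF alpha1 + constF alpha3 * vR
                    + constF alpha4 * uR * vR)
  (alpha_nsq : ~ exists b : Ruv F, alpha = b ^+ 2)
  (alpha0 : F) (alpha0E : alpha0 ^+ (p ^ s) = alpha1)
  (f u : Rconst (2 * p ^ s) alpha)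
  (fE : f = xRa ^+ 2 - toRa (constF alpha0)) (uE : u = toRa uR)
  (l t mu tor : nat) (z : Rconst (2 * p ^ s) alpha)
  (l_le : (l <= 2 * p ^ s - 1)%N) (t_lt : (t < l)%N)
  (zP : z = 0 \/ is_unit z /\ unit_form alpha0 z)
  (tor_mem : u * f ^+ tor \in ideal1 (f ^+ l + u * f ^+ t * z))
  (tor_min : forall j : nat,
     u * f ^+ j \in ideal1 (f ^+ l + u * f ^+ t * z) -> (tor <= j)%N)
  (mu_lt : (mu < tor)%N)
  (C : {set Rconst (2 * p ^ s) alpha})
  (CE : C = ideal2 (f ^+ l + u * f ^+ t * z) (u * f ^+ mu)) :
  ((mu <= p ^ s)%N -> dsp_code [set word_of c | c in C] = 2%N)
  /\ (forall Gamma gamma : nat,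
        (1 <= Gamma <= p - 1)%N -> (0 <= gamma <= s - 1)%N ->
        (2 * p ^ s - p ^ (s - gamma) + (Gamma - 1) * p ^ (s - gamma - 1) + 1
           <= mu
           <= 2 * p ^ s - p ^ (s - gamma) + Gamma * p ^ (s - gamma - 1))%N ->
        dsp_code [set word_of c | c in C] = (2 * (Gamma + 1) * p ^ gamma)%N).
Proof.
have p_gt0 := prime_gt0 p_prime.
have pcharF : p \in [pchar F] := card_finPcharP cardF p_prime.
(* The types of these variables mention [p ^ s], so they are generalized before it is renamed
   [N]. *)
move: f u fE uE z zP tor_mem tor_min C CE alpha0E l_le.
move NE: (p ^ s)%N => N f u fE uE z zP _ tor_min C CE alpha0E l_le.
have N_gt0 : (0 < N)%N by rewrite -NE expn_gt0 p_gt0.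
have n_gt0 : (0 < 2 * N)%N by rewrite muln_gt0.
have alpha0_neq0 : alpha0 != 0.
  by apply: contra_neq alpha1_neq0 => a0; rewrite -alpha0E a0 expr0n gtn_eqF.
pose Q : {poly F} := 'X^2 - alpha0%:P.
pose iota : {rmorphism {poly F} -> Rconst (2 * N) alpha} := @iota_poly F (2 *
  N) alpha.
pose V : Rconst (2 * N) alpha := toRa vR.
have QN : Q ^+ N = 'X^(2 * N) - alpha1%:P.
  rewrite /Q -{1}NE sub_exp_pchar ?pchar_poly // NE -exprM -alpha0E;
    congr (_ - _).
  by rewrite polyC_exp.
have fQ : f = iota Q.
  transitivity (iota 'X ^+ 2 - iota alpha0%:P);
    last by rewrite -rmorphXn -rmorphB.
  by rewrite fE -iota_polyX -iota_polyC.
have u_sqr : u ^+ 2 = 0 by rewrite uE expr2 -toRaM -expr2 uR_sqr rmorph0.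
have V_sqr : V ^+ 2 = 0 by rewrite /V expr2 -toRaM -expr2 vR_sqr rmorph0.
have iota_QN : iota (Q ^+ N) = V * (iota alpha3%:P + u * iota alpha4%:P).
  by rewrite QN uE; apply: iota_Xn_sub_const.
have Q_neq0 : Q != 0 by rewrite -size_poly_gt0 size_XnsubC.
have size_QN : size (Q ^+ N) = (2 * N).+1 by rewrite QN size_XnsubC.
have expand (c : Rconst (2 * N) alpha) : exists P0 P1 P2 P3,
    c = iota P0 + u * iota P1 + V * (iota P2 + u * iota P3).
  by rewrite uE; apply: Ra_expand.
have uv_eq0 (P : {poly F}) : (size P <= 2 * N)%N -> u * V * iota P = 0 -> P = 0.
  by rewrite uE; apply: uv_iota_eq0.
set g := _ + _ in tor_min CE; have gE : g = f ^+ l + u * f ^+ t * z by [].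
clearbody g; have le_l : (l <= 2 * N)%N := leq_trans l_le (leq_subr _ _).
have memC c : reflect (exists a b, c = a * g + b * (u * f ^+ mu)) (c \in C).
  rewrite CE; apply: (iffP imset2P) => [[a b _ _ ->]|[a [b ->]]];
    first by exists a, b.
  by exists a b.
have tor_min' j d : u * f ^+ j = d * g -> (tor <= j)%N.
  by move=> E; apply: tor_min; apply/imsetP; exists d.
have z_unit : z = 0 \/ exists w, z * w = 1 by case: zP => [|[]]; [left|right].
have le_mu : (mu <= 2 * N)%N.
  apply: leq_trans (ltnW mu_lt) (leq_trans _ le_l); apply: (tor_min' l u);
    rewrite gE mulrDr [u * (u * _ * z)]mulrA.
  by rewrite [u * (u * _)]mulrA -expr2 u_sqr !mul0r addr0.
(* The two words are 0 and [u Q^(N+E)], which equals [alpha3 u v Q^E]; it lies in [C] because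
   [mu <= N + E]. *)
have upper E : (E < N)%N -> (mu <= N + E)%N -> exists x y,
    [/\ x \in [set word_of c | c in C], y \in [set word_of c | c in C],
        x != y & (dsp x y <= 2 * hwt (Q ^+ E))%N].
  move=> lt_E le_E.
  have size_QE : (size (Q ^+ E) <= 2 * N)%N.
    rewrite (leq_trans (leqSpred _)) // size_exp size_XnsubC //=.
    by rewrite ltn_pmul2l.
  have u_iota_QN' := u_iota_QN u_sqr iota_QN (Q ^+ E).
  pose c := u * iota (Q ^+ N * Q ^+ E).
  have Cc : c \in C.
    apply/memC; exists 0, (f ^+ (N + E - mu)).
    by rewrite mul0r add0r mulrCA -exprD subnK // /c -exprD rmorphXn -fQ.
  have C0 : 0 \in C by apply/memC; exists 0, 0; rewrite !mul0r addr0.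
  exists (word_of c), (word_of (0 : Rconst (2 * N) alpha)); split;
    try exact: imset_f.
    rewrite (inj_eq (word_of_inj n_gt0)) /c u_iota_QN' -mulrA -rmorphM.
    apply/eqP => /uv_eq0 => /(_ _)/eqP.
    by rewrite mul_polyC size_scale //
      scaler_eq0 (negPf alpha3_neq0) expf_eq0 (negPf Q_neq0) andbF =>
      /(_ size_QE).
  rewrite dsp_word_of // subr0 /c u_iota_QN' {1}uE word_support_uv_iota //.
  apply: leq_trans (card_pair_support_le _) _;
    rewrite leq_mul2l /= (hwtE size_QE).
  by rewrite -big_mkcond sum1_card subset_leq_card //; apply/subsetP => i;
    rewrite inE.
have lower x y : x \in [set word_of c | c in C] -> y \in [set word_of c | c in
  C] ->
    x != y -> (N <= mu)%N ->
  exists P : {poly F}, [/\ Q ^+ (mu - N) %| P, P != 0, (size P <= 2 * N)%N &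
    (#|pair_support [set i : 'I_(2 * N) | (P`_i != 0)%R]| <= dsp x y)%N].
  move=> /imsetP[c1 Cc1 ->] /imsetP[c2 Cc2 ->] neq le_Nmu.
  pose c := c1 - c2.
  have nz_c : c != 0 by rewrite subr_eq0; apply: contra_neq neq => ->.
  have Cc : c \in C.
    case/memC: Cc1 => a1 [b1 c1E]; case/memC: Cc2 => a2 [b2 c2E].
    by apply/memC; exists (a1 - a2), (b1 - b2);
      rewrite /c c1E c2E !mulrBl opprD addrACA.
  (* Either [c] is already killed by [u], or [u * c] is a nonzero codeword that is, with support
     inside that of [c]. *)
  have [c' [Cc' nz_c' uc' sub_c']] : exists c', [/\ c' \in C, c' != 0, u * c'
    = 0 &
      word_support c' \subset word_support c].
    have [uc0|nz_uc] := eqVneq (u * c) 0; first by exists c.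
    exists (u * c); split=> //; last by rewrite uE word_support_toRaM.
      case/memC: Cc => a [b ->]; apply/memC; exists (u * a), (u * b).
      by rewrite mulrDr !mulrA.
    by rewrite mulrA -expr2 u_sqr mul0r.
  have /memC[a [b c'E]] := Cc'.
  have [P c'P] : exists P, c' = u * iota (Q ^+ mu * P).
    exact: (torsion_code u_sqr V_sqr alpha3_neq0 iota_QN Q_neq0 size_QN expand
      uv_eq0
      fQ gE z_unit le_l mu_lt tor_min' c'E uc').
  have [|P' /andP[dvd_P' size_P'] c'P'] := torsion_code_high u_sqr V_sqr
    iota_QN Q_neq0 size_QN P (mu := mu).
    by rewrite le_Nmu.
  exists P'; split=> //.
    by apply: contra_neq nz_c' => P'0; rewrite c'P c'P' P'0 rmorph0 mulr0.
  rewrite dsp_word_of // subset_leq_card // pair_supportS //.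
  apply: subset_trans sub_c'; rewrite c'P c'P' {1}uE word_support_uv_iota //.
split.
  (* The choice [E = 0] gives a scalar multiple of [u v], supported at one position. *)
  move=> le_muN; have [||x [y [Cx Cy neq_xy le_d]]] := upper 0%N => //;
    first by rewrite addn0.
  have le_d2 : (dsp x y <= 2)%N.
    by rewrite (leq_trans le_d) // expr0 (leq_trans (leq_mul (leqnn 2)
      (hwt_le_size _))) // size_poly1.
  apply: (dsp_code_eq Cx Cy neq_xy le_d2) =>
    x' y' /imsetP[c Cc ->] /imsetP[d Cd ->] neq.
  rewrite dsp_word_of // pair_support_gt1 // word_support_neq0 // subr_eq0.
  by apply: contra_neq neq => ->.
move=> Gamma gamma Gamma_bd gamma_bd mu_bd.
(* The top of the range of [mu], less [N]: the same exponent serves every [mu] in the range. *)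
pose E := (N - p ^ (s - gamma) + Gamma * p ^ (s - gamma - 1))%N.
have := exponent_bounds p_gt0 s_gt0 Gamma_bd gamma_bd;
  rewrite NE => /(_ _ mu_bd).
case=> lt_gs lt_E le_E le_N le_mu'.
have [x [y [Cx Cy neq_xy le_d]]] := upper E lt_E le_E.
rewrite addn1; have {}le_d : (dsp x y <= 2 * Gamma.+1 * p ^ gamma)%N.
  rewrite (leq_trans le_d) // -mulnA leq_mul2l /=.
  (* Substituting [X^2] for [X] preserves the Hamming weight. *)
  have -> : Q = ('X - alpha0%:P) \Po 'X^2
    by rewrite comp_polyB comp_polyX comp_polyC.
  by rewrite -rmorphXn /= hwt_comp_Xn // /E -NE hwt_XsubC_exp_le.
apply: (dsp_code_eq Cx Cy neq_xy le_d) => x' y' Cx' Cy' neq.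
have [P [dvd_P nz_P size_P le_P]] := lower x' y' Cx' Cy' neq le_N.
apply: leq_trans le_P.
apply: (pair_support_repeated_root pcharF _ lt_gs Gamma_bd _ alpha0_neq0 nz_P
  size_P dvd_P).
  by [].
by rewrite NE.
Qed.
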